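(* Let $G=(V,E)$ be a finite simple graph with vertex set $V=\{X_1,\ldots,X_d\}$, let $\mathbb{K}$ be a field, let $R=\mathbb{K}[X_1,\ldots,X_d]$, and let $N_G\subseteq R$ be the closed neighborhood ideal of $G$. Then $N_G$ has the following irreducible decompositions: $$N_G=\bigcap_{V'}(V')R=\bigcap_{V'\text{ min.}}(V')R,$$ where the first intersection is taken over all dominating sets $V'$ for $G$, and the second intersection is taken over all minimal dominating sets $V'$ for $G$. Furthermore, the second intersection is irredundant.
   Context: Graphs have no loops and no multi-edges; an edge between distinct vertices $X_i,X_j$ is written $X_iX_j$. The vertices $X_1,\ldots,X_d$ of $G$ are also the variables of the polynomial ring $R$. The closed neighborhood of a vertex $X_i$ is $N(X_i)=\{X_j\mid X_iX_j\in E\}\cup\{X_i\}$, its closed neighborhood monomial is $S_i=\prod_{X_j\in N(X_i)}X_j\in R$, and the closed neighborhood ideal of $G$ is $N_G=(S_1,\ldots,S_d)R$. A dominating set for $G$ is a subset $V'\subseteq V$ such that $V'\cap N(X_i)\neq\emptyset$ for every $X_i\in V$; it is minimal if it does not properly contain another dominating set. For $V'\subseteq V$, $(V')R$ denotes the ideal of $R$ generated by the variables in $V'$. An irreducible decomposition is an expression of an ideal as a finite intersection of irreducible ideals; it is irredundant if none of the ideals in the intersection contains another ideal of the intersection (equivalently for these monomial ideals, no ideal can be omitted without changing the intersection). *)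

(* Defs.v *)
From HB Require Import structures.
From mathcomp Require Import all_boot all_order all_algebra.
From mathcomp Require Import classical_sets.
From mathcomp Require Import mpoly.

Set Implicit Arguments.
Unset Strict Implicit.
Unset Printing Implicit Defensive.

Import GRing.Theory.
Local Open Scope ring_scope.
Local Open Scope classical_set_scope.

Section Ideals.
Variable R : comNzRingType.

(* Improper ideals are allowed, unlike in [idealr_closed] of ring_quotient. *)
Definition is_ideal (I : set R) : Prop :=
  I 0 /\ forall a x y : R, I x -> I y -> I (a * x + y).

Definition ideal_gen (A : set R) : set R := smallest is_ideal A.

Definition irreducible_ideal (J : set R) : Prop :=
  [/\ is_ideal J, J <> setT &
      forall I1 I2 : set R, is_ideal I1 -> is_ideal I2 ->
        J = I1 `&` I2 -> J = I1 \/ J = I2].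

(* The index type is finite, so the intersection is finite; over an empty D it
   is the whole ring. *)
Definition irreducible_decomposition (T : finType) (I : set R)
    (D : set T) (J : T -> set R) : Prop :=
  (forall t : T, D t -> irreducible_ideal (J t)) /\
  I = \bigcap_(t in D) J t.

Definition irredundant (T : finType) (D : set T) (J : T -> set R) : Prop :=
  forall s t : T, D s -> D t -> s <> t -> ~ (J s `<=` J t).

End Ideals.

(* A graph on the vertices X_0, ..., X_(d-1) is given by its adjacency relation
   e : rel 'I_d; a vertex is identified with its index. *)
Section Graphs.
Variables (d : nat) (e : rel 'I_d).

Definition closed_nbhd (i : 'I_d) : {set 'I_d} :=
  [set j | e i j || (j == i)]%SET.

Definition dominating (V : {set 'I_d}) : bool :=
  [forall i, V :&: closed_nbhd i != finset.set0].

Definition minimal_dominating (V : {set 'I_d}) : bool := minset dominating V.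

End Graphs.

Section ClosedNeighborhoodIdeal.
Variables (K : fieldType) (d : nat).

Definition closed_nbhd_monomial (e : rel 'I_d) (i : 'I_d) : {mpoly K[d]} :=
  \prod_(j in closed_nbhd e i) 'X_j.

Definition closed_nbhd_ideal (e : rel 'I_d) : set {mpoly K[d]} :=
  ideal_gen (range (closed_nbhd_monomial e)).

Definition variable_ideal (V : {set 'I_d}) : set {mpoly K[d]} :=
  ideal_gen [set 'X_j | j in [set` V]].

End ClosedNeighborhoodIdeal.

Arguments closed_nbhd_monomial K {d} e i.
Arguments closed_nbhd_ideal K {d} e.
Arguments variable_ideal K {d} V.

(* Main.v *)
Require Import Defs.
From HB Require Import structures.
From mathcomp Require Import all_boot all_order all_algebra.
From mathcomp Require Import classical_sets.
From mathcomp Require Import mpoly.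
From mathcomp Require Import boolp.

(** A polynomial lies in a monomial ideal iff each of its monomials is divisible
    by a generator.  Hence X^m lies in N_G iff the support of m contains a
    closed neighborhood, i.e. iff the complement of the support is not
    dominating, while X^m lies in (V) iff V is not contained in that
    complement.  Since every dominating set contains a minimal one, both
    intersections have the same monomials as N_G.  The ideal (V) is the kernel
    of the substitution sending the variables in V to 0, so it is prime, hence
    irreducible, and it contains X_j only for j in V, so (V) determines V. *)

Set Implicit Arguments.
Unset Strict Implicit.
Unset Printing Implicit Defensive.

Import GRing.Theory.
Local Open Scope ring_scope.
Local Open Scope classical_set_scope.

Section IdealTheory.
Variable R : comNzRingType.
Implicit Types I J A : set R.

Lemma idealMl I a x : is_ideal I -> I x -> I (a * x).
Proof. by case=> I0 Il Ix; rewrite -[a * x]addr0; apply: Il. Qed.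

Lemma ideal_sum I (T : eqType) (r : seq T) (F : T -> R) :
  is_ideal I -> (forall t, t \in r -> I (F t)) -> I (\sum_(t <- r) F t).
Proof.
case=> I0 Il IF; rewrite big_seq; elim/big_ind: _ => // x y Ix Iy.
by rewrite -[x]mul1r; apply: Il.
Qed.

Lemma ideal_gen_ideal A : is_ideal (ideal_gen A).
Proof.
split=> [J [[J0 _] _] // | a x y Ax Ay J [JI AJ]].
by apply: JI.2; [apply: Ax | apply: Ay].
Qed.

(** If [J] is the intersection of [I1] and [I2] and some [x] in [I1] lies outside [J], then [x * y]
    is in [J] for each [y] in [I2], and primality puts [y] in [J]. *)
Lemma prime_irreducible_ideal J :
  is_ideal J -> ~ J 1 -> (forall x y, J (x * y) -> J x \/ J y) ->
  irreducible_ideal J.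
Proof.
move=> JI J1 Jprime; split=> // [JT|I1 I2 I1I I2I eqJ].
  by apply: J1; rewrite JT.
have [sI1J|/existsNP[x /not_implyP[I1x nJx]]] := EM (forall x, I1 x -> J x).
  by left; apply/seteqP; split=> // x; rewrite eqJ => -[].
right; apply/seteqP; split=> [y|y I2y]; first by rewrite eqJ => -[].
have Jxy : J (x * y).
  by rewrite eqJ; split; [rewrite mulrC|]; apply: idealMl.
by case: (Jprime _ _ Jxy).
Qed.

End IdealTheory.

Lemma monomial_idealP (K : comNzRingType) (d : nat) (A : set 'X_{1..d})
    (p : {mpoly K[d]}) :
  ideal_gen [set 'X_[a] | a in A] p <->
  (forall m, m \in msupp p -> exists2 a, A a & (a <= m)%MM).
Proof.
set J := ideal_gen _; have JI : is_ideal J by apply: ideal_gen_ideal.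
split=> [|Ap]; last first.
  rewrite [p]mpolyE; apply: ideal_sum => // m /Ap[a Aa le_am].
  rewrite -mul_mpolyC -(submK le_am) mpolyXD mulrA; apply: (idealMl _ JI).
  by apply: sub_gen_smallest; exists a.
pose Q : set {mpoly K[d]} :=
  [set q | forall m, m \in msupp q -> exists2 a, A a & (a <= m)%MM].
(* [Q] is an ideal containing the generators: each monomial of a product [c * x] is a monomial of
   [x] times another one, so divisibility persists. *)
suff /(_ p): J `<=` Q by [].
apply: smallest_sub => [|_ [a Aa <-] m /mem_msuppXP <-]; last by exists a; rewrite ?lepm_refl.
split=> [m|c x y Qx Qy m]; first by rewrite msupp0.
move/msuppD_le; rewrite mem_cat => /orP[/msuppM_le|]; last exact: Qy.
case/allpairsP=> -[m1 m2] /= [_ /Qx[a Aa le_am] ->]; exists a => //.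
exact: lepm_trans le_am (lem_addl _ _).
Qed.

Section VariableIdeal.
Variables (K : fieldType) (d : nat).
Implicit Types (V : {set 'I_d}) (m : 'X_{1..d}) (p q : {mpoly K[d]}).

Lemma variable_idealP V p :
  variable_ideal K V p <->
  (forall m, m \in msupp p -> exists2 j, j \in V & m j != 0%N).
Proof.
have -> : variable_ideal K V = ideal_gen [set 'X_[a] | a in [set U_(j)%MM | j in [set` V]]].
  by rewrite image_comp.
rewrite monomial_idealP; split=> Hp m /Hp.
  by case=> _ [j Vj <-]; rewrite lep1mP; exists j.
by case=> j Vj mj; exists U_(j)%MM; [exists j | rewrite lep1mP].
Qed.

Lemma variable_idealX V (j : 'I_d) : variable_ideal K V 'X_j <-> j \in V.
Proof.
rewrite variable_idealP; split=> [/(_ U_(j)%MM)|Vj m /mem_msuppXP <-].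
  case=> [|i Vi]; first by rewrite msuppX mem_seq1.
  by rewrite mnm1E eqb0 negbK => /eqP ->.
by exists j; rewrite // mnm1E eqxx.
Qed.

(** Being a [comp_mpoly], this is a ring morphism into a domain, which makes its kernel prime. *)
Definition kill_vars V : {mpoly K[d]} -> {mpoly K[d]} :=
  comp_mpoly [tuple if i \in V then 0 else 'X_i | i < d].

Lemma kill_varsX V m :
  kill_vars V 'X_[m] =
  if [exists j in V, m j != 0%N] then 0 else 'X_[m].
Proof.
rewrite /kill_vars comp_mpolyX; case: ifPn => [/exists_inP[j Vj mj]|].
  by rewrite (bigD1 j) //= tnth_mktuple Vj expr0n (negPf mj) mul0r.
rewrite negb_exists_in => /forall_inP mV0; rewrite mpolyXE_id.
apply: eq_bigr => i _; rewrite tnth_mktuple; case: ifP => // /mV0.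
by rewrite negbK => /eqP ->; rewrite !expr0.
Qed.

Lemma kill_vars_eq0 V p : kill_vars V p = 0 <-> variable_ideal K V p.
Proof.
have JI : is_ideal (variable_ideal K V) by apply: ideal_gen_ideal.
split=> [p0|/variable_idealP Vp]; last first.
  rewrite /kill_vars comp_mpolyEX big_seq big1 // => m /Vp[j Vj mj].
  rewrite -/(kill_vars V _) kill_varsX ifT ?scaler0 //.
  by apply/exists_inP; exists j.
(* Since its image is 0, [p] equals [p - kill_vars V p], a sum of scaled differences of a monomial
   and its image; each difference is 0 or a monomial involving a variable of [V]. *)
rewrite -[p]subr0 -p0 {1}[p]mpolyE /kill_vars comp_mpolyEX -sumrB.
apply: ideal_sum => // m _; rewrite -/(kill_vars V _) kill_varsX -scalerBr.
rewrite -mul_mpolyC; apply: (idealMl _ JI).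
case: ifP => [/exists_inP[j Vj mj]|_]; last by rewrite subrr; case: JI.
rewrite subr0; apply/variable_idealP => _ /mem_msuppXP <-; by exists j.
Qed.

Lemma variable_ideal_irreducible V : irreducible_ideal (variable_ideal K V).
Proof.
apply: prime_irreducible_ideal => [||p q]; first exact: ideal_gen_ideal.
  move/kill_vars_eq0; rewrite /kill_vars comp_mpoly1.
  by apply/eqP; rewrite oner_eq0.
rewrite -!kill_vars_eq0 /kill_vars rmorphM /= => /eqP.
by rewrite mulf_eq0 => /orP[] /eqP; [left | right].
Qed.

Lemma variable_ideal_sub V V' :
  variable_ideal K V `<=` variable_ideal K V' -> V \subset V'.
Proof.
by move=> sVV'; apply/fintype.subsetP => j /variable_idealX /sVV' /variable_idealX.
Qed.

End VariableIdeal.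

Section ClosedNeighborhoodIdeal.
Variables (K : fieldType) (d : nat) (e : rel 'I_d).
Implicit Types (V : {set 'I_d}) (p : {mpoly K[d]}).

Lemma closed_nbhd_idealP p :
  closed_nbhd_ideal K e p <->
  (forall m, m \in msupp p ->
     exists i, forall j, j \in closed_nbhd e i -> m j != 0%N).
Proof.
(* The exponent of the squarefree monomial S_i is the indicator of the closed neighborhood, so S_i
   divides X^m iff [m] is nonzero there. *)
pose a i : 'X_{1..d} := (\sum_(j in closed_nbhd e i) U_(j))%MM.
have aE i j : a i j = (j \in closed_nbhd e i).
  rewrite mnm_sumE; under eq_bigr do rewrite mnm1E.
  have [Nj|Nj] := boolP (j \in closed_nbhd e i).
    by rewrite (bigD1 j) //= eqxx big1 // => k /andP[_ /negPf ->].
  by rewrite big1 // => k Nk; case: eqP Nj => // <-; rewrite Nk.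
have -> : closed_nbhd_ideal K e = ideal_gen [set 'X_[b] | b in range a].
  rewrite image_comp; congr (ideal_gen (_ @` _)); apply: funext => i.
  exact: mprodXE.
rewrite monomial_idealP; split=> Hp m /Hp.
  case=> _ [i _ <-] /mnm_lepP le_am; exists i => j Nj.
  by have:= le_am j; rewrite aE Nj lt0n.
case=> i Ni; exists (a i); first by exists i.
by apply/mnm_lepP => j; rewrite aE; have [/Ni|] := boolP (j \in _); rewrite -?lt0n.
Qed.

Lemma closed_nbhd_ideal_sub V :
  dominating e V -> closed_nbhd_ideal K e `<=` variable_ideal K V.
Proof.
move/forallP=> domV p /closed_nbhd_idealP Np; apply/variable_idealP => m /Np[i Ni].
by have /set0Pn[j /setIP[Vj /Ni mj]] := domV i; exists j.
Qed.

(** Serves both decompositions, as intersecting over all dominating sets gives a smaller ideal. *)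
Lemma bigcap_minimal_dominating_sub :
  \bigcap_(V in [set V | minimal_dominating e V]) variable_ideal K V
    `<=` closed_nbhd_ideal K e.
Proof.
move=> p Vp; apply/closed_nbhd_idealP => m mp.
suff /existsP[i /forall_inP Ni] :
    [exists i, forall (j | j \in closed_nbhd e i), m j != 0%N] by exists i.
apply: contraT; rewrite negb_exists => /forallP nN.
(* If no closed neighborhood lies in the support of [m], each one meets the complement [V0], so [V0]
   dominates. A minimal dominating [V] inside [V0] then contradicts [p] being in the ideal of
   [V]. *)
pose V0 := [set j | m j == 0%N]%SET.
have domV0 : dominating e V0.
  apply/forallP => i; have := nN i; rewrite negb_forall_in => /exists_inP[j Nj].
  by rewrite negbK => mj; apply/set0Pn; exists j; rewrite inE Nj inE mj.
have [V minV sVV0] := minset_exists domV0.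
have [j /(fintype.subsetP sVV0)] := (variable_idealP V p).1 (Vp V minV) m mp.
by rewrite inE => ->.
Qed.

Lemma minimal_dominatingW V : minimal_dominating e V -> dominating e V.
Proof. exact: minsetp. Qed.

End ClosedNeighborhoodIdeal.

Theorem proposition2p6 (K : fieldType) (d : nat) (e : rel 'I_d)
    (e_sym : ssrbool.symmetric e) (e_irr : irreflexive e) :
  [/\ irreducible_decomposition (closed_nbhd_ideal K e)
        [set V : {set 'I_d} | dominating e V] (variable_ideal K),
      irreducible_decomposition (closed_nbhd_ideal K e)
        [set V : {set 'I_d} | minimal_dominating e V] (variable_ideal K) &
      irredundant
        [set V : {set 'I_d} | minimal_dominating e V] (variable_ideal K)].
Proof.
split.
- split=> [V _|]; first exact: variable_ideal_irreducible.
  apply/seteqP; split=> [p Np V domV|p Vp]; first exact: closed_nbhd_ideal_sub Np.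
  by apply: bigcap_minimal_dominating_sub => V /minimal_dominatingW; apply: Vp.
- split=> [V _|]; first exact: variable_ideal_irreducible.
  apply/seteqP; split; last exact: bigcap_minimal_dominating_sub.
  by move=> p Np V /minimal_dominatingW domV; apply: closed_nbhd_ideal_sub Np.
- move=> V V' /minimal_dominatingW domV minV' neqVV' /variable_ideal_sub sVV'.
  (* A dominating set contained in the minimal [V'] must equal it. *)
  exact/neqVV'/(minsetinf minV').
Qed.
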